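(* Let $H$ be a real Hilbert space, let $\mathcal D\subset H$ be a dictionary, and let $f\in\mathcal A_1(\mathcal D)\subset H$. Then every output $(f_m)_{m\ge 0}$ of the Rescaled Pure Greedy Algorithm RPGA($\mathcal D$) applied to $f$ satisfies $$\|f-f_m\|\le |f|_{\mathcal A_1(\mathcal D)}\,m^{-1/2},\qquad m=1,2,\dots.$$
   Context: $H$ is a real Hilbert space with inner product $\langle\cdot,\cdot\rangle$ and norm $\|f\|=\langle f,f\rangle^{1/2}$. Dictionary: a set $\mathcal D\subset H$ with $\|\varphi\|=1$ for every $\varphi\in\mathcal D$ such that the closure of $\mathrm{span}(\mathcal D)$ is $H$. For $M>0$ let $\mathcal A_1^{o}(\mathcal D,M)$ be the set of all finite sums $\sum_{k\in\Lambda}c_k\varphi_k$ with $\varphi_k\in\mathcal D$, $|\Lambda|<\infty$ and $\sum_{k\in\Lambda}|c_k|\le M$, and let $\mathcal A_1(\mathcal D,M)$ be its closure in $H$. Put $\mathcal A_1(\mathcal D)=\bigcup_{M>0}\mathcal A_1(\mathcal D,M)$ and, for $f\in\mathcal A_1(\mathcal D)$, $|f|_{\mathcal A_1(\mathcal D)}=\inf\{M: f\in\mathcal A_1(\mathcal D,M)\}$. RPGA($\mathcal D$) applied to $f$ produces a sequence $(f_m)_{m\ge0}$ as follows. Step 0: $f_0:=0$. Step $m\ge1$: if $f_{m-1}=f$, the algorithm has stopped and $f_k:=f$ for all $k\ge m$. If $f_{m-1}\ne f$, choose $\varphi_m\in\mathcal D$ such that $$|\langle f-f_{m-1},\varphi_m\rangle|=\sup_{\varphi\in\mathcal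 D}|\langle f-f_{m-1},\varphi\rangle|$$ (it is assumed that such a choice exists at each step; it need not be unique), and set $$\lambda_m:=\langle f-f_{m-1},\varphi_m\rangle,\quad \hat f_m:=f_{m-1}+\lambda_m\varphi_m,\quad s_m:=\frac{\langle f,\hat f_m\rangle}{\|\hat f_m\|^2},\quad f_m:=s_m\hat f_m .$$ *)

(* Defs.v *)
From mathcomp Require Export all_boot all_order all_algebra.
From mathcomp Require Export all_classical all_reals all_analysis.

Set Implicit Arguments.
Unset Strict Implicit.
Unset Printing Implicit Defensive.
Import Order.TTheory GRing.Theory Num.Theory.
Import numFieldNormedType.Exports.
Local Open Scope classical_set_scope.
Local Open Scope ring_scope.

(* A real Hilbert space is a complete normed module H over R together with a
   symmetric positive definite bilinear form (the type {dot H for idfun} of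
   sesquilinear.v) that induces the norm of H, and hence its topology. *)
Definition induces_norm (R : realType) (H : completeNormedModType R)
    (ip : {dot H for idfun}) : Prop :=
  forall x : H, `|x| = Num.sqrt (ip x x).

Definition linear_span (R : realType) (H : completeNormedModType R)
    (D : set H) : set H :=
  [set x | exists (n : nat) (c : 'I_n -> R) (phi : 'I_n -> H),
     (forall k, D (phi k)) /\ x = \sum_k c k *: phi k].

Definition dictionary (R : realType) (H : completeNormedModType R)
    (D : set H) : Prop :=
  (forall phi, D phi -> `|phi| = 1) /\ closure (linear_span D) = setT.

Definition A1o (R : realType) (H : completeNormedModType R)
    (D : set H) (M : R) : set H :=
  [set x | exists (n : nat) (c : 'I_n -> R) (phi : 'I_n -> H),
     [/\ forall k, D (phi k), \sum_k `|c k| <= M & x = \sum_k c k *: phi k]].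

Definition A1_ball (R : realType) (H : completeNormedModType R)
    (D : set H) (M : R) : set H :=
  closure (A1o D M).

Definition A1 (R : realType) (H : completeNormedModType R)
    (D : set H) : set H :=
  \bigcup_(M in [set M : R | 0 < M]) A1_ball D M.

(* For f in A1 D the set is nonempty and bounded below by 0, so that inf is a
   genuine infimum; outside A1 D the value is the default value 0 of inf. *)
Definition A1_norm (R : realType) (H : completeNormedModType R)
    (D : set H) (f : H) : R :=
  inf [set M : R | 0 < M /\ A1_ball D M f].

(* fnext is a possible successor of the approximation fprev when fprev <> f;
   the supremum is over a set bounded by `|f - fprev| (Cauchy-Schwarz), and it
   is attained at phi. *)
Definition RPGA_step (R : realType) (H : completeNormedModType R)
    (ip : {dot H for idfun}) (D : set H) (f fprev fnext : H) : Prop :=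
  exists phi : H,
    [/\ D phi,
        `|ip (f - fprev) phi| = sup [set `|ip (f - fprev) psi| | psi in D] &
        let lambda := ip (f - fprev) phi in
        let fhat := fprev + lambda *: phi in
        let s := ip f fhat / `|fhat| ^+ 2 in
        fnext = s *: fhat].

(* The maximizers phi need not be unique: any sequence obtained from some
   choice of maximizers is an output. *)
Definition RPGA_output (R : realType) (H : completeNormedModType R)
    (ip : {dot H for idfun}) (D : set H) (f : H) (fs : nat -> H) : Prop :=
  fs 0%N = 0 /\
  forall m : nat,
    (fs m = f -> forall k, (m < k)%N -> fs k = f) /\
    (fs m <> f -> RPGA_step ip D f (fs m) (fs m.+1)).

(* Main.v *)
Require Import Defs.
From mathcomp Require Import all_boot all_order all_algebra.
From mathcomp Require Import all_classical all_reals all_analysis.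
From mathcomp Require Import ring lra.
Set Implicit Arguments.
Unset Strict Implicit.
Unset Printing Implicit Defensive.
Import Order.TTheory GRing.Theory Num.Theory.
Import numFieldNormedType.Exports.
Local Open Scope classical_set_scope.
Local Open Scope ring_scope.

(** Rescaling makes the residual r = f - f_m orthogonal to f_m, so that
    |r|^2 = <r, f> <= M sup_D |<r, phi>| whenever f lies in A_1(D, M). As f_(m+1)
    is at least as close to f as the pure greedy step, a_m = |f - f_m|^2 obeys
    a_(m+1) <= a_m (1 - a_m / M^2) with a_0 <= M^2, whence (m + 1) a_m <= M^2. *)

Lemma ip_sym (R : realType) (H : completeNormedModType R)
  (ip : {dot H for idfun}) (x y : H) : ip x y = ip y x.
Proof. by rewrite hermC /= expr0 mul1r. Qed.

Lemma ipZr (R : realType) (H : completeNormedModType R)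
  (ip : {dot H for idfun}) (a : R) (x y : H) : ip x (a *: y) = a * ip x y.
Proof. exact: linearZr_LR. Qed.

Lemma induces_norm_sqr (R : realType) (H : completeNormedModType R)
  (ip : {dot H for idfun}) : induces_norm ip -> forall x, ip x x = `|x| ^+ 2.
Proof.
move=> ip_norm x; rewrite ip_norm sqr_sqrtr //.
have [->|x0] := eqVneq x 0; first by rewrite linear0l.
by apply: ltW; apply: neq0_dnorm_gt0.
Qed.

Lemma induces_norm_sqrBZ (R : realType) (H : completeNormedModType R)
  (ip : {dot H for idfun}) : induces_norm ip -> forall (a : R) (x y : H),
  `|x - a *: y| ^+ 2 = `|x| ^+ 2 - 2 * a * ip x y + a ^+ 2 * `|y| ^+ 2.
Proof.
move=> ip_norm a x y; have ipE := induces_norm_sqr ip_norm.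
rewrite -ipE linearBl /= !linearBr /= !(ip_sym ip (a *: y)) !ipZr.
by rewrite (ip_sym ip (_ *: y)) ipZr !ipE; ring.
Qed.

Lemma induces_norm_cauchy_schwarz (R : realType) (H : completeNormedModType R)
  (ip : {dot H for idfun}) : induces_norm ip ->
  forall x y, `|ip x y| <= `|x| * `|y|.
Proof.
move=> ip_norm x y.
rewrite -ler_sqr ?nnegrE ?mulr_ge0 // real_normK ?num_real // -subr_ge0.
have [->|y0] := eqVneq y 0.
  by rewrite linear0r expr0n subr0 sqr_ge0.
have y_gt0 : 0 < `|y| ^+ 2 by rewrite exprn_gt0 // normr_gt0.
(* The vector here is the residual of projecting [x] onto the line of [y]; its squared norm times
   [|y| ^+ 2] is the gap in the squared inequality. *)
have := mulr_ge0 (sqr_ge0 `|x - (ip x y / `|y| ^+ 2) *: y|) (ltW y_gt0).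
rewrite (induces_norm_sqrBZ ip_norm).
rewrite [X in 0 <= X -> _](_ : _ = (`|x| * `|y|) ^+ 2 - ip x y ^+ 2) //.
by field; rewrite normr_eq0.
Qed.

(** Bilinearity gives the bound for finite combinations, and Cauchy-Schwarz carries it to the
    closure. *)
Lemma ip_A1_ball_le (R : realType) (H : completeNormedModType R)
  (ip : {dot H for idfun}) (D : set H) (M S : R) (r f : H) :
  induces_norm ip -> 0 <= S -> (forall phi, D phi -> `|ip r phi| <= S) ->
  A1_ball D M f -> `|ip r f| <= M * S.
Proof.
move=> ip_norm S0 rS fM; apply/ler_addgt0Pr => e e0.
(* This radius makes the approximation error cost at most [e]; the [+ 1] covers [r = 0]. *)
have d0 : 0 < e / (`|r| + 1) by rewrite divr_gt0 // ltr_wpDl.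
have [x [[n [c [phi [Dphi cM ->]]]]]] := fM _ (nbhsx_ballx f _ d0).
rewrite -ball_normE /=; set x0 := \sum_k _ => fx.
have -> : ip r f = ip r x0 + ip r (f - x0) by rewrite linearBr /= addrC subrK.
apply: le_trans (ler_normD _ _) _; apply: lerD.
  have -> : ip r x0 = \sum_k c k * ip r (phi k).
    by rewrite linear_sumr; apply: eq_bigr => k _; exact: ipZr.
  apply: le_trans (ler_norm_sum _ _ _) _.
  apply: le_trans (ler_wpM2r S0 cM); rewrite mulr_suml; apply: ler_sum => k _.
  by rewrite normrM ler_wpM2l // rS.
apply: le_trans (induces_norm_cauchy_schwarz ip_norm _ _) _.
apply: le_trans (ler_wpM2l (normr_ge0 r) (ltW fx)) _.
rewrite mulrCA ger_pMr // ler_pdivrMr ?mul1r; first by rewrite lerDl.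
by rewrite ltr_wpDl.
Qed.

(** The vector [p] is the orthogonal projection of [f] onto the line of [g]; for [g = 0] it is 0. *)
Lemma ip_rescale_orthogonal (R : realType) (H : completeNormedModType R)
  (ip : {dot H for idfun}) (f g : H) : induces_norm ip ->
  let p := (ip f g / `|g| ^+ 2) *: g in ip (f - p) p = 0.
Proof.
move=> ip_norm /=; have [->|g0] := eqVneq g 0; first by rewrite scaler0 linear0r.
have n0 : `|g| ^+ 2 != 0 by rewrite expf_eq0 normr_eq0.
rewrite linearBl /= !ipZr (ip_sym ip (_ *: g)) ipZr (induces_norm_sqr ip_norm).
by rewrite divfK // subrr.
Qed.

(** The projection of [f] minimizes the distance to the line of [g]. With [s] the rescaling factor,
    the two sides differ by the square of [|g| * (1 - s)]. *)
Lemma ip_rescale_closest (R : realType) (H : completeNormedModType R)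
  (ip : {dot H for idfun}) (f g : H) : induces_norm ip ->
  `|f - (ip f g / `|g| ^+ 2) *: g| ^+ 2 <= `|f - g| ^+ 2.
Proof.
move=> ip_norm.
have [->|g0] := eqVneq g 0; first by rewrite scaler0.
have n0 : `|g| ^+ 2 != 0 by rewrite expf_eq0 normr_eq0.
set s := ip f g / _; have sE : ip f g = s * `|g| ^+ 2 by rewrite /s divfK.
rewrite -{2}(scale1r g) !(induces_norm_sqrBZ ip_norm) sE -subr_ge0.
rewrite (_ : _ - _ = (`|g| * (1 - s)) ^+ 2) ?sqr_ge0 //; ring.
Qed.

Lemma RPGA_step_decrease (R : realType) (H : completeNormedModType R)
  (ip : {dot H for idfun}) (D : set H) (M : R) (f g h : H) :
  induces_norm ip -> dictionary D -> 0 < M -> A1_ball D M f ->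
  ip (f - g) g = 0 -> RPGA_step ip D f g h ->
  M ^+ 2 * `|f - h| ^+ 2 <= `|f - g| ^+ 2 * (M ^+ 2 - `|f - g| ^+ 2).
Proof.
move=> ip_norm [D1 _] M0 fM orth [phi [Dphi phi_max ->]].
have ipE := induces_norm_sqr ip_norm.
set r := f - g in orth phi_max *.
set l := ip r phi in phi_max *.
set fh := g + _.
have rl psi : D psi -> `|ip r psi| <= `|l|.
  (* The supremum dominates its members because Cauchy-Schwarz and the unit norms bound the set by
     [|r|]. *)
  move=> Dpsi; rewrite phi_max; apply: ub_le_sup; last by exists psi.
  exists `|r| => _ [u Du <-].
  by rewrite -[leRHS]mulr1 -(D1 _ Du); exact: induces_norm_cauchy_schwarz.
have rM : `|r| ^+ 2 <= M * `|l|.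
  apply: le_trans (ip_A1_ball_le ip_norm (normr_ge0 l) rl fM).
  (* Since [r] is orthogonal to [g], pairing [r] with [f] or with [f - g = r] gives the same
     value. *)
  rewrite (_ : ip r f = `|r| ^+ 2) ?ler_norm // -ipE.
  by rewrite [in RHS]/r linearBr /= orth subr0.
have r4 : (`|r| ^+ 2) ^+ 2 <= M ^+ 2 * l ^+ 2.
  rewrite -[l ^+ 2]real_normK ?num_real // -exprMn.
  by rewrite ler_sqr ?nnegrE ?sqr_ge0 ?mulr_ge0 // ltW.
(* The pure greedy step removes from [r] its component along the unit vector [phi]. *)
have pure : `|f - fh| ^+ 2 = `|r| ^+ 2 - l ^+ 2.
  rewrite /fh opprD addrA -/r (induces_norm_sqrBZ ip_norm) -/l (D1 _ Dphi).
  by ring.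
have := ler_wpM2l (sqr_ge0 M) (ip_rescale_closest f fh ip_norm).
by rewrite pure; lra.
Qed.

Lemma recursive_bound_step (R : realFieldType) (a b B : R) (m : nat) :
  0 < B -> 0 <= a -> m.+1%:R * a <= B -> B * b <= a * (B - a) ->
  m.+2%:R * b <= B.
Proof.
move=> B0 a0 aB bB; rewrite -(ler_pM2l B0) mulrCA.
apply: le_trans (ler_wpM2l (ler0n _ _) bB) _.
move: aB; rewrite -(natr1 m.+1); set k := m.+1%:R => aB.
have k1 : 1 <= k by rewrite /k ler1n.
have aB1 : a <= B by apply: le_trans aB; rewrite ler_peMl.
(* The map [a * (B - a)] is not monotone in [a], so the bound on [a] cannot just be substituted.
   Instead, [B ^+ 2 - (k + 1) * a * (B - a) = (B - a) * (B - k * a) + a ^+ 2]. *)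
have := mulr_ge0 (_ : 0 <= B - a) (_ : 0 <= B - k * a).
rewrite !subr_ge0 => /(_ aB1 aB); have := sqr_ge0 a; rewrite expr2; lra.
Qed.

Lemma RPGA_output_orthogonal (R : realType) (H : completeNormedModType R)
  (ip : {dot H for idfun}) (D : set H) (f : H) (fs : nat -> H) :
  induces_norm ip -> RPGA_output ip D f fs ->
  forall m, ip (f - fs m) (fs m) = 0.
Proof.
move=> ip_norm [fs0 fsS] [|m]; first by rewrite fs0 linear0r.
have [stop step] := fsS m; have [/stop ->//|/step] := pselect (fs m = f).
  by rewrite subrr linear0l.
by move=> [phi [_ _ ->]]; exact: ip_rescale_orthogonal.
Qed.

Lemma RPGA_output_bound (R : realType) (H : completeNormedModType R)
  (ip : {dot H for idfun}) (D : set H) (M : R) (f : H) (fs : nat -> H) :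
  induces_norm ip -> dictionary D -> RPGA_output ip D f fs ->
  0 < M -> A1_ball D M f ->
  forall m, m.+1%:R * `|f - fs m| ^+ 2 <= M ^+ 2.
Proof.
move=> ip_norm D_dict fs_out M0 fM.
have M20 : 0 < M ^+ 2 by rewrite exprn_gt0.
elim=> [|m IHm].
  (* Base case [|f| <= M]: taking [r = f] and [S = |f|] in [ip_A1_ball_le] gives
     [|f| ^+ 2 <= M * |f|]. *)
  rewrite fs_out.1 subr0 mul1r ler_sqr ?nnegrE ?(ltW M0) //.
  have [->|f0] := eqVneq f 0; first by rewrite normr0 ltW.
  have f_gt0 : 0 < `|f| by rewrite normr_gt0.
  rewrite -(ler_pM2r f_gt0) -expr2 -(induces_norm_sqr ip_norm).
  apply: le_trans (ler_norm _) _; apply: ip_A1_ball_le fM => // phi Dphi.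
  rewrite -[leRHS]mulr1 -(D_dict.1 _ Dphi).
  exact: induces_norm_cauchy_schwarz.
have [stop step] := fs_out.2 m; have [/stop ->//|/step fm] := pselect (fs m = f).
  by rewrite subrr normr0 expr0n mulr0 ltW.
clear stop step; apply: recursive_bound_step IHm _; rewrite ?sqr_ge0 //.
apply: RPGA_step_decrease fm => //.
exact: RPGA_output_orthogonal fs_out m.
Qed.

Theorem theorem3p1 (R : realType) (H : completeNormedModType R)
    (ip : {dot H for idfun}) (ip_norm : induces_norm ip)
    (D : set H) (D_dict : dictionary D)
    (f : H) (fA1 : A1 D f)
    (fs : nat -> H) (fs_out : RPGA_output ip D f fs)
    (m : nat) (m_ge1 : (1 <= m)%N) :
  `|f - fs m| <= A1_norm D f * m%:R `^ (- (1 / 2)).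
Proof.
have m0 : 0 < m%:R :> R by rewrite ltr0n.
have s0 : 0 < Num.sqrt m%:R :> R by rewrite sqrtr_gt0.
rewrite powRN div1r powR12_sqrt ?(ltW m0) // ler_pdivlMr //.
(* With the infimum alone on the right, it suffices to treat each admissible [M]; [fA1] provides
   one, so [inf] does not take its default value. *)
apply: lb_le_inf; first by case: fA1 => M M0 fM; exists M.
move=> M [M0 fM].
rewrite -ler_sqr ?nnegrE ?mulr_ge0 ?sqrtr_ge0 ?(ltW M0) //.
rewrite exprMn sqr_sqrtr ?(ltW m0) // mulrC.
(* The factor [m.+1] proved by induction is weakened to [m]. *)
apply: le_trans (RPGA_output_bound ip_norm D_dict fs_out M0 fM m).
by rewrite ler_wpM2r ?sqr_ge0 // ler_nat.
Qed.
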